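(* For every integer $t\geq 1$, every graph that does not contain $K^*_{3,t}$ as a minor is $3$-colourable with defect $4t$, and is $6$-colourable with clustering $2t$.
   Context: All graphs are finite and simple. $K^*_{3,t}$ denotes the complete join of $K_3$ and $\overline{K_t}$: a triangle together with $t$ pairwise non-adjacent vertices each adjacent to all three triangle vertices. A graph is $k$-colourable with defect $d$ if its vertices can be given one of $k$ colours (not necessarily properly) so that each vertex has at most $d$ neighbours of its own colour; it is $k$-colourable with clustering $c$ if its vertices can be given one of $k$ colours so that every connected component of each colour class has at most $c$ vertices. *)

(* Defs.v *)
From mathcomp Require Import all_boot.

Set Implicit Arguments.
Unset Strict Implicit.
Unset Printing Implicit Defensive.

Record sgraph := SGraph {
  vertex :> finType;
  adj : rel vertex;
  adj_sym : symmetric adj;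
  adj_irr : irreflexive adj }.

Section CompleteGraph.
Variable n : nat.

Definition complete_adj : rel 'I_n := [rel x y | x != y].

Lemma complete_adj_sym : symmetric complete_adj.
Proof. by move=> x y; rewrite /complete_adj /= eq_sym. Qed.

Lemma complete_adj_irr : irreflexive complete_adj.
Proof. by move=> x; rewrite /complete_adj /= eqxx. Qed.

Definition complete : sgraph := SGraph complete_adj_sym complete_adj_irr.
End CompleteGraph.

Section Complement.
Variable G : sgraph.

Definition complement_adj : rel G := [rel x y | (x != y) && ~~ adj x y].

Lemma complement_adj_sym : symmetric complement_adj.
Proof. by move=> x y; rewrite /complement_adj /= eq_sym adj_sym. Qed.

Lemma complement_adj_irr : irreflexive complement_adj.
Proof. by move=> x; rewrite /complement_adj /= eqxx. Qed.

Definition complement : sgraph := SGraph complement_adj_sym complement_adj_irr.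
End Complement.

Section Join.
Variables G H : sgraph.

Definition join_adj : rel (G + H)%type := fun u v =>
  match u, v with
  | inl x, inl y => adj x y
  | inr x, inr y => adj x y
  | _, _ => true
  end.

Lemma join_adj_sym : symmetric join_adj.
Proof. by move=> [x|x] [y|y] //=; rewrite adj_sym. Qed.

Lemma join_adj_irr : irreflexive join_adj.
Proof. by move=> [x|x] /=; rewrite adj_irr. Qed.

Definition join : sgraph := SGraph join_adj_sym join_adj_irr.
End Join.

Definition Kstar3 (t : nat) : sgraph := join (complete 3) (complement (complete t)).

Section Connectivity.
Variable G : sgraph.

Definition adj_in (S : {set G}) : rel G :=
  [rel x y | [&& x \in S, y \in S & adj x y]].

Definition connected (S : {set G}) : Prop :=
  S != set0 /\ {in S &, forall x y, connect (adj_in S) x y}.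

(* The vertex sets of the connected components of the subgraph induced by S. *)
Definition components (S : {set G}) : {set {set G}} :=
  equivalence_partition (connect (adj_in S)) S.
End Connectivity.

(* H is obtained, up to isomorphism, from a subgraph of G by contracting edges:
   B x is the set of vertices of G contracted to the vertex x of H. *)
Definition minor (H G : sgraph) : Prop :=
  exists B : H -> {set G},
    [/\ forall x, connected (B x),
        forall x y, x != y -> [disjoint B x & B y]
      & forall x y, adj x y ->
          exists u v, [/\ u \in B x, v \in B y & adj u v]].

Definition colour_class (G : sgraph) (k : nat) (f : G -> 'I_k) (i : 'I_k) :
  {set G} := [set v | f v == i].

Definition colourable_with_defect (G : sgraph) (k d : nat) : Prop :=
  exists f : G -> 'I_k, forall v : G, #|[set w | adj v w & f w == f v]| <= d.

Definition colourable_with_clustering (G : sgraph) (k c : nat) : Prop :=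
  exists f : G -> 'I_k, forall (i : 'I_k) (C : {set G}),
    C \in components (colour_class f i) -> #|C| <= c.

(* Main.v *)
Require Import Defs.
From mathcomp Require Import all_boot.

(* Colour G recursively, the uncoloured set C having all its outside neighbours
   in two disjoint, adjacent connected sets A and B, where the coloured
   neighbours of C in A have colour a and those in B have colour b. Let B1 be
   the part of C reachable from B while avoiding N(A), and let H be the set of
   vertices of C adjacent both to A and to the connected set B + B1. Give H the
   third colour c: since H separates B1 from the rest D of C, one can recurse on
   B1 with (A + H, B) and on D with (A, B + B1 + H). A connected set S inside H
   with t neighbours in H - S would yield a K*_{3,t} minor with triangle A,
   B + B1, S; so every connected monochromatic set has fewer than t neighbours
   of its colour. Single vertices give the defect bound; distance layers in each
   monochromatic component, coloured by parity, give the clustering bound. *)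

Set Implicit Arguments.
Unset Strict Implicit.
Unset Printing Implicit Defensive.

(** * Neighbourhoods and connected sets *)

Lemma subset_setUDK (T : finType) (A B : {set T}) :
  A \subset B -> A :|: B :\: A = B.
Proof. by move=> /setIidPr sAB; rewrite -{1}sAB setID. Qed.

Lemma disjoint_setUr (T : finType) (A B C : {set T}) :
  [disjoint A & B] -> [disjoint A & C] -> [disjoint A & B :|: C].
Proof.
move=> dAB dAC; apply/pred0P=> w /=; rewrite in_setU.
by case wA: (w \in A); rewrite //= (disjointFr dAB wA) (disjointFr dAC wA).
Qed.

Section ConnectedSets.
Variable G : sgraph.
Implicit Types (S T L X Y : {set G}) (x y v w : G).

Definition nbr S : {set G} := [set w | [exists v in S, adj v w]].

Lemma nbrP S w : reflect (exists2 v, v \in S & adj v w) (w \in nbr S).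
Proof. by rewrite inE; apply: (iffP exists_inP). Qed.

Lemma nbr_self v w : (w \in nbr [set v]) = adj v w.
Proof.
apply/nbrP/idP => [[u /set1P ->] //|vw].
by exists v => //; apply: set11.
Qed.

(** [connected] without non-emptiness: the sets enclosing the recursion, and the explored set of the
    layering, may be empty. *)
Definition linked S := {in S &, forall x y, connect (adj_in S) x y}.

Lemma adj_inE S x y : adj_in S x y = [&& x \in S, y \in S & adj x y].
Proof. by []. Qed.

Lemma adj_in_csym S : connect_sym (adj_in S).
Proof.
by apply: sym_connect_sym => x y; rewrite !adj_inE adj_sym andbCA.
Qed.

Lemma sub_connect_adj_in S T x y :
  S \subset T -> connect (adj_in S) x y -> connect (adj_in T) x y.
Proof.
move=> /subsetP sST; apply: connect_sub => u v /and3P[uS vS uv].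
by apply: connect1; rewrite adj_inE !sST.
Qed.

(** Each step of a path in [X] keeps it inside [Y], so the path itself is a path in [Y]. *)
Lemma connect_adj_in_closed X Y x y :
  {in Y & X, forall u v, adj u v -> v \in Y} -> x \in Y ->
  connect (adj_in X) x y -> y \in Y /\ connect (adj_in Y) x y.
Proof.
move=> clY xY /connectP[p]; elim: p x xY => [|z p IHp] x xY /=.
  by move=> _ ->.
case/andP=> /and3P[_ zX xz] pth last_p.
have zY : z \in Y by apply: clY xz.
have [yY zy] := IHp z zY pth last_p; split=> //.
by apply: connect_trans zy; apply: connect1; rewrite adj_inE xY zY.
Qed.

Lemma linked0 : linked set0.
Proof. by move=> x y; rewrite inE. Qed.

Lemma linked1 v : linked [set v].
Proof. by move=> x y /set1P -> /set1P ->; apply: connect0. Qed.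

Lemma linked_sup S T :
  linked S -> S \subset T ->
  {in T, forall x, exists2 s, s \in S & connect (adj_in T) x s} -> linked T.
Proof.
move=> lS sST toS x y /toS[s sS xs] /toS[s' s'S ys'].
apply: connect_trans xs _; rewrite adj_in_csym; apply: connect_trans ys' _.
by apply: sub_connect_adj_in sST _; apply: lS.
Qed.

Lemma linkedU_nbr S L : linked S -> L \subset nbr S -> linked (S :|: L).
Proof.
move=> lS /subsetP sLN; apply: (linked_sup lS (subsetUl _ _)) => x.
case/setUP=> xSL; first by exists x.
have /nbrP[s sS sx] := sLN x xSL; exists s => //.
by apply: connect1; rewrite adj_inE adj_sym sx !inE xSL sS orbT.
Qed.

Lemma linked_inside S X :
  linked S -> {in S & S, forall x y, adj x y -> x \in X -> y \in X} ->
  S \subset X \/ [disjoint S & X].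
Proof.
move=> lS clX; case: (pickP [pred x in S | x \in X]) => [x /andP[xS xX]|noX].
  left; apply/subsetP=> y yS.
  have clSX : {in S :&: X & S, forall u v, adj u v -> v \in S :&: X}.
    move=> u v /setIP[uS uX] vS uv.
    by rewrite inE vS (clX u v).
  have xSX : x \in S :&: X by rewrite inE xS.
  by have [/setIP[]] := connect_adj_in_closed clSX xSX (lS x y xS yS).
right; apply/pred0P=> x; exact: noX x.
Qed.

End ConnectedSets.

(** * Building a $K^*_{3,t}$ minor *)

Section Minor.
Variables (t : nat) (G : sgraph).
Implicit Types (A B S T : {set G}).

(** The triangle contracts from [A], [B], [S]; the independent vertices are [t] single vertices of
    [T]. *)
Lemma Kstar3_minor A B S T :
  connected A -> connected B -> connected S ->
  [disjoint A & B] -> [disjoint A & S] -> [disjoint B & S] ->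
  (exists2 a, a \in A & a \in nbr B) ->
  [disjoint T & A] -> [disjoint T & B] -> [disjoint T & S] ->
  S :|: T \subset nbr A -> S :|: T \subset nbr B -> T \subset nbr S ->
  t <= #|T| -> minor (Kstar3 t) G.
Proof.
move=> cA cB cS dAB dAS dBS [a aA aB] dTA dTB dTS.
move=> /subsetP nA /subsetP nB /subsetP nS tT.
pose leaf (i : 'I_t) : G := enum_val (widen_ord tT i).
have leafT i : leaf i \in T by apply: enum_valP.
have leaf_inj : injective leaf.
  by move=> i j /enum_val_inj/(congr1 val) /= ij; apply: val_inj.
have [s sS] : exists s, s \in S by case: cS => /set0Pn.
(* The default value [S] of [nth] serves as the third triangle set. *)
pose hub (i : 'I_3) := nth S [:: A; B] i.
pose br (x : Kstar3 t) : {set G} :=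
  match x with inl i => hub i | inr i => [set leaf i] end.
pose joined (X Y : {set G}) := exists u v : G, [/\ u \in X, v \in Y & adj u v].
have joinedC (X Y : {set G}) : joined X Y -> joined Y X.
  by case=> u [v [uX vY uv]]; exists v, u; rewrite adj_sym.
have nbr_joined (X Y : {set G}) w : w \in nbr X -> w \in Y -> joined X Y.
  by case/nbrP=> u uX uw wY; exists u, w.
have jAB : joined A B by apply/joinedC/(nbr_joined _ _ _ aB aA).
have jAS : joined A S by apply: (nbr_joined _ _ s) => //; apply: nA; rewrite inE sS.
have jBS : joined B S by apply: (nbr_joined _ _ s) => //; apply: nB; rewrite inE sS.
have hub_leaf i j : joined (hub i) [set leaf j].
  have lT := leafT j; apply: (nbr_joined _ _ (leaf j)); last exact: set11.
  by case: i => [[|[|[|//]]] Hi]; [apply: nA|apply: nB|apply: nS]; rewrite ?inE ?lT ?orbT.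
have leaf_disj i j : [disjoint hub i & [set leaf j]].
  rewrite disjoint_sym disjoints1.
  by apply/negbT; case: i => [[|[|[|//]]] Hi]; apply: (disjointFr _ (leafT j)).
exists br; split=> [[i|i]|[i|i] [j|j] //|[i|i] [j|j] //] /=.
- by case: i => [[|[|[|//]]] Hi].
- by split; [apply/set0Pn; exists (leaf i); apply: set11|apply: linked1].
- move: i j => [[|[|[|//]]] Hi] [[|[|[|//]]] Hj] //= _;
    by rewrite /hub /= // disjoint_sym.
- by move=> _; apply: leaf_disj.
- by move=> _; rewrite disjoint_sym; apply: leaf_disj.
- move=> ij; rewrite disjoints1 inE; apply: contraNneq ij => /leaf_inj->.
  exact: eqxx.
- move: i j => [[|[|[|//]]] Hi] [[|[|[|//]]] Hj] //= _; rewrite /hub /=;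
    first [done | exact: joinedC].
- by move=> _; apply: hub_leaf.
- by move=> _; apply/joinedC/hub_leaf.
by case/andP=> ij /negP[].
Qed.

End Minor.

(** * Sparse and clustered colourings, and how to glue them *)

Section MonochromaticSets.
Variables (G : sgraph) (K : eqType) (t : nat).
Implicit Types (f : G -> K) (C P Q S T : {set G}).

Definition mono f S := {in S &, forall x y, f x = f y}.

Definition mono_nbr f C S : {set G} :=
  [set w in C :\: S | [exists v in S, adj v w && (f w == f v)]].

(** Neighbours are counted only inside [C], so colourings of separate parts can be glued. All
    connected monochromatic sets are tested, since the layering applies the bound to unions of
    layers. *)
Definition sparse f C :=
  forall S, S \subset C -> connected S -> mono f S -> #|mono_nbr f C S| < t.

Definition clustered f C :=
  forall S, S \subset C -> connected S -> mono f S -> #|S| <= t.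

Lemma eq_mono f f' S : {in S, f =1 f'} -> mono f' S -> mono f S.
Proof. by move=> ff' fS x y xS yS; rewrite !ff' //; apply: fS. Qed.

Lemma eq_sparse f f' C : {in C, f =1 f'} -> sparse f C -> sparse f' C.
Proof.
move=> ff' spf S sSC cS mS.
have ff'S : {in S, f =1 f'} by move=> x /(subsetP sSC)/ff'.
apply: leq_ltn_trans (spf S sSC cS (eq_mono ff'S mS)).
apply/subset_leq_card/subsetP=> w; rewrite !inE.
case/andP=> /andP[wS wC] /exists_inP[v vS /andP[vw fw]].
by rewrite wS wC; apply/exists_inP; exists v; rewrite // vw ff' // ff'S.
Qed.

Lemma eq_clustered f f' C : {in C, f =1 f'} -> clustered f C -> clustered f' C.
Proof.
move=> ff' clf S sSC cS mS; apply: clf => //; apply: eq_mono mS.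
by move=> x /(subsetP sSC)/ff'.
Qed.

(** Leaving [P] for [Q] within [S] would take an edge between two colours. *)
Lemma mono_split f P Q S :
  {in P & Q, forall x y, adj x y -> f x != f y} ->
  S \subset P :|: Q -> connected S -> mono f S -> S \subset P \/ S \subset Q.
Proof.
move=> PQ /subsetP sS [_ lS] mS; have [|sSP|dSP] := @linked_inside _ _ P lS.
- move=> x y xS yS xy xP; case/setUP: (sS y yS) => // yQ.
  by have /eqP[] := PQ x y xP yQ xy; apply: mS.
- by left.
right; apply/subsetP=> x xS; case/setUP: (sS x xS) => // xP.
by rewrite (disjointFr dSP xS) in xP.
Qed.

Lemma clusteredU f P Q :
  {in P & Q, forall x y, adj x y -> f x != f y} ->
  clustered f P -> clustered f Q -> clustered f (P :|: Q).
Proof.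
move=> PQ clP clQ S sS cS mS.
by case: (mono_split PQ sS cS mS) => sSX; [apply: clP|apply: clQ].
Qed.

Lemma mono_nbrU f P Q S :
  {in P & Q, forall x y, adj x y -> f x != f y} -> S \subset P ->
  mono_nbr f (P :|: Q) S \subset mono_nbr f P S.
Proof.
move=> PQ /subsetP sSP; apply/subsetP=> w; rewrite !inE.
case/andP=> /andP[-> wPQ] /exists_inP[v vS /andP[vw fw]] /=.
apply/andP; split; last by apply/exists_inP; exists v; rewrite ?vw.
by case/orP: wPQ => // wQ; have := PQ v w (sSP v vS) wQ vw; rewrite eq_sym fw.
Qed.

Lemma sparseU f P Q :
  {in P & Q, forall x y, adj x y -> f x != f y} ->
  sparse f P -> sparse f Q -> sparse f (P :|: Q).
Proof.
move=> PQ spP spQ S sS cS mS.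
have QP : {in Q & P, forall x y, adj x y -> f x != f y}.
  by move=> x y xQ yP; rewrite adj_sym eq_sym; apply: PQ.
case: (mono_split PQ sS cS mS) => sSX.
  by apply: leq_ltn_trans (spP S sSX cS mS); apply/subset_leq_card/mono_nbrU.
rewrite setUC; apply: leq_ltn_trans (spQ S sSX cS mS).
exact/subset_leq_card/mono_nbrU.
Qed.

Lemma sparse0 f : sparse f set0.
Proof. by move=> S; rewrite subset0 => /eqP -> []; rewrite eqxx. Qed.

Lemma clustered0 f : clustered f set0.
Proof. by move=> S; rewrite subset0 => /eqP -> []; rewrite eqxx. Qed.

Lemma sparse1 f v : 0 < t -> sparse f [set v].
Proof.
move=> t_gt0 S; rewrite subset1 => /orP[]/eqP -> [nzS _] _; last by rewrite eqxx in nzS.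
rewrite [mono_nbr _ _ _](_ : _ = set0) ?cards0 //.
by apply/setP=> w; rewrite !inE andNb.
Qed.

Lemma clustered_small f C : #|C| <= t -> clustered f C.
Proof. by move=> leCt S sSC _ _; apply: leq_trans leCt; apply: subset_leq_card. Qed.

End MonochromaticSets.

(** * The recursive 3-colouring *)

Lemma third_colour (a b : 'I_3) : exists c : 'I_3, (c != a) && (c != b).
Proof.
by case: a b => [[|[|[|//]]] Ha] [[|[|[|//]]] Hb];
  (by exists (inord 0); rewrite -!val_eqE /= inordK) ||
  (by exists (inord 1); rewrite -!val_eqE /= inordK) ||
  (by exists (inord 2); rewrite -!val_eqE /= inordK).
Qed.

Section ThreeColours.
Variables (t : nat) (G : sgraph).
Hypotheses (t_gt0 : 0 < t) (noK : ~ minor (Kstar3 t) G).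
Implicit Types (A B C H S : {set G}) (a b c : 'I_3).

(** A connected [S] with [t] neighbours in [H] gives the minor whatever [f] is: these neighbours are
    attached to [A], [B] and [S]. *)
Lemma sparse_common_nbr (f : G -> 'I_3) A B H :
  linked A -> linked B -> [disjoint A & B] ->
  (A != set0 -> B != set0 -> exists2 u, u \in A & u \in nbr B) ->
  [disjoint H & A] -> [disjoint H & B] ->
  H \subset nbr A -> H \subset nbr B -> sparse t f H.
Proof.
move=> lA lB dAB adjAB dHA dHB nA nB S sSH cS mS.
rewrite ltnNge; apply/negP=> tT; apply: noK.
have [s sS] : exists s, s \in S by case: cS => /set0Pn.
have sH := subsetP sSH s sS.
have nzA : A != set0.
  by have /nbrP[u uA _] := subsetP nA s sH; apply/set0Pn; exists u.
have nzB : B != set0.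
  by have /nbrP[u uB _] := subsetP nB s sH; apply/set0Pn; exists u.
have sTH : mono_nbr f H S \subset H.
  by apply/subsetP=> w; rewrite !inE => /andP[/andP[]].
have sSTH : S :|: mono_nbr f H S \subset H by rewrite subUset sSH.
apply: (Kstar3_minor (conj nzA lA) (conj nzB lB) cS dAB) tT.
- by rewrite disjoint_sym; apply: disjointWl dHA.
- by rewrite disjoint_sym; apply: disjointWl dHB.
- exact: adjAB.
- exact: disjointWl dHA.
- exact: disjointWl dHB.
- by apply/pred0P=> w; rewrite !inE; case: (w \in S) => //=; rewrite andbF.
- exact: subset_trans nA.
- exact: subset_trans nB.
apply/subsetP=> w; rewrite inE => /andP[_ /exists_inP[v vS /andP[vw _]]].
by apply/nbrP; exists v.
Qed.

(* [A] or [B] may be empty: this covers the start of the recursion and the case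
   where [C] has no coloured neighbour. *)
Definition enclosed C A B :=
  [/\ linked A, linked B, [disjoint A & B],
      A != set0 -> B != set0 -> exists2 u, u \in A & u \in nbr B &
      [/\ [disjoint C & A], [disjoint C & B] & nbr C \subset A :|: B :|: C]].

(** The colours on [A] and [B] are not stored: avoiding [a] next to [A] and [b] next to [B] is all
    that gluing requires. *)
Definition extends f C A B a b :=
  [/\ {in C, forall v, v \in nbr A -> f v != a},
      {in C, forall v, v \in nbr B -> f v != b} & sparse t f C].

Definition extendable_below n := forall C A B a b,
  #|C| < n -> enclosed C A B -> a != b -> exists f, extends f C A B a b.

(** With only one enclosing set, a vertex [v] of [C] gets colour [b] and becomes the second one. *)
Lemma extend_one C A a b :
  extendable_below #|C| -> C != set0 -> linked A -> [disjoint C & A] ->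
  nbr C \subset A :|: C -> a != b ->
  exists2 f, {in C, forall v, v \in nbr A -> f v != a} & sparse t f C.
Proof.
move=> IH nzC lA dCA sNC ab.
(* If possible [v] is a neighbour of [A], making [A] and [[set v]] adjacent, and [A0] is [A].
   Otherwise [A] is irrelevant to [C]: [A0] is empty and [v] arbitrary. *)
have [v [A0 [vC [lA0 dCA0 sNC0 adjA0 sA0]]]] : exists v A0, v \in C /\
    [/\ linked A0, [disjoint C & A0], nbr C \subset A0 :|: C,
    A0 != set0 -> v \in nbr A0 & {in C, forall u, u \in nbr A -> u \in nbr A0}].
  case: (pickP [pred v in C | v \in nbr A]) => [v /andP[vC vA]|noA].
    by exists v, A; do 2!split=> //.
  have [v vC] := set0Pn _ nzC; exists v, set0; split=> //; split.
  - exact: linked0.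
  - by rewrite disjoint_sym disjoints_subset sub0set.
  - apply/subsetP=> w wNC; have /setUP[wA|wC] := subsetP sNC w wNC; last by rewrite !inE wC orbT.
    have /nbrP[u uC uw] := wNC; have := noA u; rewrite /= uC /=.
    by move/negbT/nbrP; case; exists w; rewrite // adj_sym.
  - by rewrite eqxx.
  - by move=> u uC uA; have := noA u; rewrite /= uC uA.
have vA0 : v \notin A0 by rewrite (disjointFr dCA0 vC).
have [||f [fA fv spf]] := IH (C :\ v) A0 [set v] a b _ _ ab.
- by rewrite [X in _ < X](cardsD1 v) vC.
- split=> //; first exact: linked1.
  + by rewrite disjoint_sym disjoints1.
  + by case/adjA0/nbrP=> // u uA0 uv _; exists u => //; rewrite nbr_self adj_sym.
  split.
  + by apply: disjointWl dCA0; apply: subD1set.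
  + by rewrite disjoint_sym disjoints1 !inE eqxx.
  apply/subsetP=> w /nbrP[u /setD1P[_ uC] uw].
  have /(subsetP sNC0) : w \in nbr C by apply/nbrP; exists u.
  by rewrite !inE; case: eqP => //= _; rewrite ?orbT ?orbF.
pose f' u := if u == v then b else f u.
have ff' : {in C :\ v, f =1 f'} by move=> u /setD1P[/negPf uv _]; rewrite /f' uv.
exists f' => [u uC /(sA0 u uC) uA|].
  rewrite /f'; case: (eqVneq u v) => [_|uv]; first by rewrite eq_sym.
  by apply: fA => //; rewrite !inE uv.
rewrite -(setD1K vC); apply: sparseU; [|exact: sparse1|exact: eq_sparse spf].
move=> _ u /set1P -> uCv vu; rewrite -(ff' u uCv) /f' eqxx eq_sym.
by apply: fv; rewrite // nbr_self.
Qed.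

Lemma extend_step C A B a b :
  extendable_below #|C| -> enclosed C A B -> a != b ->
  exists f, extends f C A B a b.
Proof.
move=> IH [lA lB dAB adjAB [dCA dCB sNC]] ab.
have [->|nzC] := eqVneq C set0.
  by exists (fun=> a); split; [move=> v; rewrite inE..|apply: sparse0].
(* If [C] misses [nbr A] or [nbr B], one enclosing set remains and [extend_one] applies. *)
case: (pickP [pred v in C | v \in nbr A]) => [pA /andP[pAC pAA]|noA]; last first.
  have [||f fB spf] := extend_one IH nzC lB dCB _ (_ : b != a).
  - apply/subsetP=> w wNC; have := subsetP sNC w wNC; rewrite -setUA => /setUP[wA|//].
    have /nbrP[u uC uw] := wNC; have := noA u; rewrite /= uC /=.
    by move/negbT/nbrP; case; exists w; rewrite // adj_sym.
  - by rewrite eq_sym.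
  by exists f; split=> // v vC vA; have := noA v; rewrite /= vC vA.
case: (pickP [pred v in C | v \in nbr B]) => [pB /andP[pBC pBB]|noB]; last first.
  have [|f fA spf] := extend_one IH nzC lA dCA _ ab.
    apply/subsetP=> w wNC; have := subsetP sNC w wNC; rewrite setUAC => /setUP[//|wB].
    have /nbrP[u uC uw] := wNC; have := noB u; rewrite /= uC /=.
    by move/negbT/nbrP; case; exists w; rewrite // adj_sym.
  by exists f; split=> // v vC vB; have := noB v; rewrite /= vC vB.
have [c /andP[ca cb]] := third_colour a b.
pose X := C :\: nbr A.
(* The union of the components of [C] minus [nbr A] that meet [nbr B]. *)
pose B1 := [set v in X | [exists u in X, (u \in nbr B) && connect (adj_in X) u v]].
have B1P v : reflect (v \in X /\ exists u, [/\ u \in X, u \in nbr B & connect (adj_in X) u v])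
                     (v \in B1).
  rewrite [v \in B1]in_set; apply: (iffP andP) => [[vX /exists_inP[u uX /andP[]]]|[vX [u [uX uB uv]]]].
    by split=> //; exists u.
  by split=> //; apply/exists_inP; exists u; rewrite ?uB.
have sB1X : B1 \subset X by apply/subsetP=> v /B1P[].
have sXC : X \subset C by apply: subsetDl.
have sB1C := subset_trans sB1X sXC.
have B1cl : {in B1 & X, forall u v, adj u v -> v \in B1}.
  move=> u v /B1P[uX [w [wX wB wu]]] vX uv; apply/B1P; split=> //.
  exists w; split=> //; apply: connect_trans wu _; apply: connect1.
  by rewrite adj_inE uX vX.
have nbrB_B1 v : v \in X -> v \in nbr B -> v \in B1.
  by move=> vX vB; apply/B1P; split=> //; exists v.
pose BB := B :|: B1; pose H := C :&: nbr A :&: nbr BB; pose D := C :\: (H :|: B1).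
have sHC : H \subset C by rewrite /H -setIA subsetIl.
have sHA : H \subset nbr A by rewrite /H setIAC subsetIr.
have sHBB : H \subset nbr BB by apply: subsetIr.
have sDC : D \subset C by apply: subsetDl.
have defC : C = H :|: B1 :|: D.
  by rewrite subset_setUDK // subUset sHC.
(* A path in [X] starting at a neighbour of [B] stays in [B1], by [B1cl]. *)
have lBB : linked BB.
  apply: (linked_sup lB (subsetUl _ _)) => x /setUP[xB|]; first by exists x.
  case/B1P=> xX [u [uX uB ux]].
  have uB1 := nbrB_B1 u uX uB.
  have [_ ux1] := connect_adj_in_closed B1cl uB1 ux.
  have /nbrP[s sB su] := uB; exists s => //.
  rewrite adj_in_csym; apply: (@connect_trans _ _ u).
    by apply: connect1; rewrite adj_inE su !in_setU sB uB1 !orbT.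
  by apply: sub_connect_adj_in ux1; apply: subsetUr.
have dABB : [disjoint A & BB].
  by apply: disjoint_setUr => //; rewrite disjoint_sym; apply: disjointWl dCA.
have nbrS S (T : {set G}) : S \subset T -> nbr S \subset nbr T.
  move=> /subsetP sST; apply/subsetP=> w /nbrP[v vS vw].
  by apply/nbrP; exists v; rewrite ?sST.
have nzB : B != set0 by have /nbrP[u uB _] := pBB; apply/set0Pn; exists u.
have nzA : A != set0 by have /nbrP[u uA _] := pAA; apply/set0Pn; exists u.
have [u0 u0A u0B] := adjAB nzA nzB.
have spH (f : G -> 'I_3) : sparse t f H.
  apply: (@sparse_common_nbr f A BB) => //.
  - by move=> _ _; exists u0 => //; apply: subsetP (nbrS _ _ (subsetUl _ _)) _ u0B.
  - exact: disjointWl dCA.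
  apply: disjoint_setUr; first exact: disjointWl dCB.
  apply/pred0P=> w /=; apply/andP=> -[/(subsetP sHA) wA].
  by move/(subsetP sB1X)/setDP=> [_ /negP[]].
have DX v : v \in D -> v \in nbr A -> v \notin nbr BB.
  move=> /setDP[vC]; rewrite in_setU negb_or => /andP[vH _] vA.
  by apply: contra vH => vBB; do 2!(apply/setIP; split=> //).
(* The separation: a vertex of [C] with a neighbour in [BB] lies in [H] if it is adjacent to [A],
   and in [B1] otherwise. *)
have DnB v : v \in D -> v \notin nbr BB.
  move=> vD; have [vA|vA] := boolP (v \in nbr A); first exact: DX.
  have /setDP[vC] := vD; rewrite in_setU negb_or => /andP[_ vB1].
  have vX : v \in X by apply/setDP.
  apply: contra vB1 => /nbrP[u /setUP[uB|uB1] uv].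
    by apply: nbrB_B1 => //; apply/nbrP; exists u.
  exact: B1cl uv.
have B1nA v : v \in B1 -> v \notin nbr A by move/(subsetP sB1X)/setDP=> [].
have pAB1 : pA \notin B1 by apply: contraL pAA => /B1nA.
(* Both parts shrink: [pA], adjacent to [A], is outside [B1], and [pB], adjacent to [B], is outside
   [D]. *)
have ltB1 : #|B1| < #|C|.
  by apply/proper_card/properP; split=> //; exists pA.
have ltD : #|D| < #|C|.
  apply/proper_card/properP; split=> //; exists pB => //.
  by apply/negP=> /DnB/negP[]; apply: subsetP (nbrS _ _ (subsetUl _ _)) _ pBB.
(* [BB :|: H] may count as coloured [c], because [D] meets only the [H] part through edges. *)
have [||f1 [f1A f1H spf1]] := IH D A (BB :|: H) a c ltD.
- split=> //; first exact: linkedU_nbr.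
  + by apply: disjoint_setUr => //; rewrite disjoint_sym; apply: disjointWl dCA.
  + move=> _ _; exists u0 => //; apply: subsetP u0B; apply: nbrS.
    by rewrite /BB -setUA subsetUl.
  split.
  + exact: disjointWl dCA.
  + rewrite -setUA; apply: disjoint_setUr; first exact: disjointWl dCB.
    by apply/pred0P=> w /=; rewrite /D [B1 :|: H]setUC in_setD -andbA andbCA andNb andbF.
  apply/subsetP=> w /(subsetP (nbrS _ _ sDC))/(subsetP sNC).
  rewrite {1}defC /BB !in_setU.
  by case: (w \in A) (w \in B) (w \in B1) (w \in H) => [] [] [] [].
- by rewrite eq_sym.
(* Symmetrically, [A :|: H] may count as coloured [c], because [B1] has no neighbour in [A]. *)
have [||f2 [f2A f2B spf2]] := IH B1 (A :|: H) B c b ltB1.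
- split=> //; first exact: linkedU_nbr.
  + rewrite disjoint_sym; apply: disjoint_setUr; rewrite disjoint_sym //.
    exact: disjointWl dCB.
  + by move=> _ _; exists u0; rewrite // inE u0A.
  split.
  + apply: disjoint_setUr; first exact: disjointWl dCA.
    by apply/pred0P=> w /=; apply/andP=> -[/B1nA/negP wA /(subsetP sHA)/wA].
  + exact: disjointWl dCB.
  apply/subsetP=> w /nbrP[u uB1 uw].
  have /(subsetP sNC)/setUP[/setUP[wA|wB]|wC] : w \in nbr C.
    by apply/nbrP; exists u => //; apply: subsetP uB1.
  - by rewrite !in_setU wA.
  - by rewrite !in_setU wB orbT.
  have [wA|wA] := boolP (w \in nbr A).
    have wH : w \in H.
      rewrite 2!in_setI wC wA /=.
      by apply/nbrP; exists u; rewrite // in_setU uB1 orbT.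
    by rewrite !in_setU wH !orbT.
  have wB1 : w \in B1 by apply: B1cl uB1 _ uw; apply/setDP.
  by rewrite in_setU wB1 orbT.
- by [].
pose f u := if u \in H then c else if u \in B1 then f2 u else f1 u.
have fH u : u \in H -> f u = c by rewrite /f => ->.
have HB1 u : u \in B1 -> u \in H = false.
  by move=> /B1nA uA; apply: contraNF uA => /(subsetP sHA).
have fB1 u : u \in B1 -> f u = f2 u by move=> uB1; rewrite /f (HB1 u uB1) uB1.
have fD u : u \in D -> f u = f1 u.
  by case/setDP=> _; rewrite in_setU negb_or /f => /andP[/negPf-> /negPf->].
have caseC u : u \in C -> [\/ u \in H, u \in B1 | u \in D].
  by rewrite defC => /setUP[/setUP[]|] uX; [constructor 1|constructor 2|constructor 3].
exists f; split.
- move=> v /caseC[vH|vB1|vD] vA; first by rewrite fH.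
    by have := B1nA v vB1; rewrite vA.
  by rewrite fD ?f1A.
- move=> v /caseC[vH|vB1|vD] vB; first by rewrite fH.
    by rewrite fB1 ?f2B.
  have := DnB v vD.
  by rewrite (subsetP (nbrS _ _ (subsetUl _ _)) _ vB).
(* No edge between parts is monochromatic: [f1] and [f2] avoid [c] next to [H], and no edge joins
   [B1] to [D]. *)
rewrite defC; apply: sparseU.
- move=> x y /setUP[xH|xB1] yD xy; rewrite (fD y yD).
    rewrite fH // eq_sym; apply: f1H => //; apply/nbrP; exists x => //.
    by rewrite in_setU xH orbT.
  have /nbrP[] := DnB y yD; exists x => //.
  by rewrite in_setU xB1 orbT.
- apply: sparseU => //.
    move=> x y xH yB1 xy; rewrite fH // fB1 // eq_sym; apply: f2A => //.
    by apply/nbrP; exists x; rewrite // in_setU xH orbT.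
  by apply: eq_sparse spf2 => u /fB1.
by apply: eq_sparse spf1 => u /fD.
Qed.

Lemma sparse_colouring : exists f : G -> 'I_3, sparse t f [set: G].
Proof.
have ext n : extendable_below n.
  elim: n => // n IHn C A B a b; rewrite ltnS => leCn encl ab.
  by apply: extend_step => // C' A' B' a' b' ltC'; apply: IHn; apply: leq_trans leCn.
have d0 S : [disjoint S & set0].
  by rewrite disjoint_sym disjoints_subset sub0set.
have encl : enclosed [set: G] set0 set0.
  by split; rewrite ?eqxx ?d0 ?setUT ?subsetT //; apply: linked0.
(* Empty enclosing sets impose nothing, so any two distinct colours can start the recursion. *)
have [f [_ _ spf]] := ext _ _ _ _ ord0 ord_max (ltnSn _) encl isT.
by exists f.
Qed.

End ThreeColours.

(** * From a sparse colouring to defect and clustering *)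

Lemma sparse_defect (t k : nat) (G : sgraph) (f : G -> 'I_k) v :
  sparse t f [set: G] -> #|[set w | adj v w & f w == f v]| < t.
Proof.
move=> spf.
have cv : connected [set v].
  by split; [apply/set0Pn; exists v; apply: set11|apply: linked1].
apply: leq_ltn_trans (spf _ (subsetT _) cv _); last by move=> x y /set1P-> /set1P->.
apply/subset_leq_card/subsetP=> w; rewrite !inE => /andP[vw fw].
rewrite andbT; apply/andP; split; last by apply/exists_inP; exists v; rewrite ?set11 ?vw.
by apply: contraTneq vw => ->; rewrite adj_irr.
Qed.

(* The colour [g] alternates along the distance layers of each [f]-monochromatic
   component; [S] is the part already explored from its root. *)
Lemma sparse_layering (t : nat) (G : sgraph) (K : eqType) (f : G -> K) :
  0 < t -> sparse t f [set: G] ->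
  forall n (L S : {set G}) (b : bool),
  #|L| < n -> linked S -> mono f S -> [disjoint S & L] ->
  exists g : G -> bool,
    {in S & L, forall x y, adj x y -> f x = f y -> g y = b} /\
    clustered t (fun u => (f u, g u)) L.
Proof.
move=> t_gt0 spf; elim=> // n IHn L S b; rewrite ltnS => leLn lS mS dSL.
have [->|nzL] := eqVneq L set0.
  by exists (fun=> b); split=> //; apply: clustered0.
pose T := [set y in L | [exists x in S, adj x y && (f y == f x)]].
have TP y : reflect (y \in L /\ exists x, [/\ x \in S, adj x y & f y = f x]) (y \in T).
  rewrite inE; apply: (iffP andP) => [[yL /exists_inP[x xS /andP[xy /eqP yx]]]|[yL [x [xS xy yx]]]].
    by split=> //; exists x.
  by split=> //; apply/exists_inP; exists x; rewrite // xy yx /=.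
(* [M] is the block coloured [b] now, and [S'] is explored afterwards. If [T] is non-empty it is the
   next layer; otherwise exploration restarts from a fresh root [v], forgetting [S]. *)
have [M [S' [nzM leMt sML [lS' mS' dS'] [sMS' sTM]]]] : exists M S' : {set G},
    [/\ M != set0, #|M| <= t, M \subset L,
    [/\ linked S', mono f S' & [disjoint S' & L :\: M]] &
    M \subset S' /\ T \subset M].
  have [T0|nzT] := eqVneq T set0.
    have [v vL] := set0Pn _ nzL; exists [set v], [set v].
    rewrite T0 sub0set subxx sub1set cards1 vL disjoints1 !inE eqxx; split=> //.
      by apply/set0Pn; exists v; apply: set11.
    by split=> //; [apply: linked1|move=> x y /set1P-> /set1P->].
  exists T, (S :|: T).
  have sTL : T \subset L by apply/subsetP=> y /TP[].
  have [y0 /TP[y0L [x0 [x0S _ _]]]] := set0Pn _ nzT.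
  have fS u : u \in S :|: T -> f u = f x0.
    case/setUP=> [uS|/TP[_ [x [xS _ ->]]]]; exact: mS.
  split=> //; [|split|by rewrite subsetUr].
  (* The next layer consists of same-coloured neighbours of the connected set [S], so sparsity
     bounds it. *)
  - apply: ltnW; have cS : connected S by split=> //; apply/set0Pn; exists x0.
    apply: leq_ltn_trans (spf S (subsetT _) cS mS); apply/subset_leq_card/subsetP=> y yT.
    have /TP[yL [x [xS xy yx]]] := yT.
    rewrite !inE (disjointFl dSL yL); apply/exists_inP; exists x => //.
    by rewrite xy yx /=.
  - apply: linkedU_nbr => //; apply/subsetP=> y /TP[_ [x [xS xy _]]].
    by apply/nbrP; exists x.
  - by move=> x y /fS-> /fS->.
  apply/pred0P=> w; rewrite /= in_setU in_setD.
  case: (w \in T); rewrite ?andbF // orbF /=.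
  by case wS: (w \in S) => //=; rewrite (disjointFr dSL wS).
have ltLM : #|L :\: M| < n.
  apply: leq_trans leLn; apply/proper_card/properP; split; first exact: subsetDl.
  have [v vM] := set0Pn _ nzM; exists v; first exact: subsetP vM.
  by rewrite inE vM.
(* Flipping [b] makes later vertices that share the [f]-colour of an adjacent vertex of [M] differ
   from it in [g]. *)
have [g [gS' clg]] := IHn _ _ (~~ b) ltLM lS' mS' dS'.
pose g' u := if u \in M then b else g u.
exists g'; split.
  move=> x y xS yL xy fxy; rewrite /g' (subsetP sTM) //.
  by apply/TP; split=> //; exists x.
rewrite -(subset_setUDK sML); apply: clusteredU.
- move=> x y xM /setDP[yL yM] xy; rewrite /g' xM (negPf yM) xpair_eqE.
  apply/nandP; case: eqP => [fxy|_]; [right|by left].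
  by rewrite (gS' x) //; [case: b {g' gS'}|apply: subsetP xM|rewrite inE yM].
- exact: clustered_small.
by apply: eq_clustered clg => u /setDP[_ uM]; rewrite /g' (negPf uM).
Qed.

Lemma sparse_clustered (t k : nat) (G : sgraph) (f : G -> 'I_k) :
  0 < t -> sparse t f [set: G] -> colourable_with_clustering G (k.*2) t.
Proof.
move=> t_gt0 spf.
have [||g [_ clg]] := sparse_layering t_gt0 spf true (ltnSn #|[set: G]|) (@linked0 G).
- by move=> x y; rewrite inE.
- by rewrite disjoints_subset sub0set.
(* The pair of colours is encoded as one number: its parity is [g v] and its half is [f v]. *)
have lt_h v : g v + (f v).*2 < k.*2.
  by have := ltn_ord (f v); rewrite -leq_double; apply: leq_trans; rewrite doubleS; case: (g v).
exists (fun v => Ordinal (lt_h v)) => i C.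
set X := colour_class _ i => /imsetP[r rX ->].
(* The class of [r] is connected within itself, since paths in [X] from [r] stay in [Y]. *)
set Y := [set y in X | _].
have YE y : (y \in Y) = (y \in X) && connect (adj_in X) r y by rewrite inE.
have clY : {in Y & X, forall u v, adj u v -> v \in Y}.
  move=> u v; rewrite !YE => /andP[uX ru] vX uv; rewrite vX.
  by apply: connect_trans ru (connect1 _); rewrite adj_inE uX vX.
have rY : r \in Y by rewrite YE rX connect0.
apply: clg; first exact: subsetT.
  split; first by apply/set0Pn; exists r.
  have toY y : y \in Y -> connect (adj_in Y) r y.
    by rewrite YE => /andP[_ ry]; have [] := connect_adj_in_closed clY rY ry.
  by move=> x y /toY rx /toY; apply: connect_trans; rewrite adj_in_csym.
move=> x y; rewrite !YE !inE => /andP[/eqP hx _] /andP[/eqP hy _].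
have /(congr1 val)/= hxy := etrans hx (esym hy).
have gxy : g x = g y by have := congr1 odd hxy; rewrite !oddD !odd_double !addbF !oddb.
congr (_, _) => //; apply: val_inj; move: hxy; rewrite gxy => /addnI.
exact: double_inj.
Qed.

Theorem theorem17 (t : nat) (ht : 1 <= t) (G : sgraph) (hG : ~ minor (Kstar3 t) G) :
  colourable_with_defect G 3 (4 * t) /\ colourable_with_clustering G 6 (2 * t).
Proof.
(* One sparse [f] serves both claims, with defect below [t] and clustering [t]. *)
have [f spf] := sparse_colouring ht hG; split.
  exists f => v; apply: leq_trans (ltnW (sparse_defect v spf)) _.
  by rewrite leq_pmull.
have [h clh] := sparse_clustered ht spf.
by exists h => i C Ci; apply: leq_trans (clh i C Ci) _; rewrite leq_pmull.
Qed.
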